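(* Let $p$ be a prime, $e\ge 1$ an integer, $q=p^e$, and let $\mathcal{H}=\mathbb{F}_{q^2}(X,Y)$ with $X^{q+1}+Y^{q+1}+1=0$ be the Hermitian function field, with Cartier operator $\mathcal{C}$. For positive integers $i,j$ put $$\omega_{i,j}=\frac{X^iY^j}{X\,Y\,(q+1)Y^{q}}\,dX .$$ Then for all positive integers $i,j$ with $i+j<q+1$, we have $\mathcal{C}(\omega_{i,j})=0$ exactly when $i\not\equiv 0 \pmod p$, $j\not\equiv 0\pmod p$ and $(i \bmod p)+(j\bmod p)\le p$. Otherwise, $$\mathcal{C}(\omega_{i,j})=(-1)^{\left\lceil \frac{jp^{e-1}}{q+1}\right\rceil+j}\binom{(j-1)\bmod p}{(p-i)\bmod p}\,\omega_{\tilde{\imath},\tilde{\jmath}},$$ where $\tilde{\imath}=(q+1)\left\lceil\frac{ip^{e-1}}{q+1}\right\rceil-ip^{e-1}$ and $\tilde{\jmath}=(q+1)\left\lceil\frac{jp^{e-1}}{q+1}\right\rceil-jp^{e-1}$.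
   Context: For integers $a$ and $b\geq 1$, $a \bmod b$ denotes the residue of $a$ in $\{0,1,\dots,b-1\}$. Cartier operator: let $F/K$ be a function field over a perfect field $K$ of characteristic $p>0$ and let $t$ be a separating element. Every differential $\omega$ of $F/K$ can be written uniquely as $\omega=(x_0^p+x_1^pt+\cdots+x_{p-1}^pt^{p-1})\,dt$ with $x_i\in F$, and $\mathcal{C}(\omega):=x_{p-1}\,dt$; this does not depend on $t$. The $\omega_{i,j}$ with $i,j\geq 1$ and $i+j<q+1$ form a basis of the space of holomorphic differentials of $\mathcal{H}$ (note that $q+1=1$ in characteristic $p$, so the factor $q+1$ in the denominator is invertible). *)

(* Defs.v *)
From HB Require Import structures.
From mathcomp Require Import all_boot all_order all_algebra all_field.
From mathcomp Require Import boolp classical_sets.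

Set Implicit Arguments.
Unset Strict Implicit.
Unset Printing Implicit Defensive.

Import Order.TTheory GRing.Theory Num.Theory.
Local Open Scope ring_scope.

(* Throughout, an extension F/K is given by its embedding iota : K -> F. *)

(* z lies in the field K(A) generated by the set A over K, i.e. in every
   subfield of F that contains K and A. *)
Definition in_adjoin (K F : fieldType) (iota : {rmorphism K -> F})
    (A : set F) (z : F) : Prop :=
  forall S : {pred F}, divring_closed S ->
    (forall c : K, iota c \in S) -> (forall a : F, A a -> a \in S) -> z \in S.

(* F/K(t) is a separable algebraic extension.  For a function field F/K it is
   then automatically finite. *)
Definition separating (K F : fieldType) (iota : {rmorphism K -> F}) (t : F) :
    Prop :=
  forall z : F, exists P : {poly F},
    [/\ separable_poly P, root P z
      & forall k : nat, in_adjoin iota [set t]%classic P`_k].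

Definition derivation (K F : fieldType) (iota : {rmorphism K -> F})
    (M : lmodType F) (delta : F -> M) : Prop :=
  [/\ forall x y : F, delta (x + y) = delta x + delta y,
      forall x y : F, delta (x * y) = x *: delta y + y *: delta x
    & forall c : K, delta (iota c) = 0].

(* (Omega, d) is the module of differentials of F/K, characterized, up to a
   unique isomorphism, by its universal property. *)
Definition differential_module (K F : fieldType) (iota : {rmorphism K -> F})
    (Omega : lmodType F) (d : F -> Omega) : Prop :=
  derivation iota d /\
  forall (M : lmodType F) (delta : F -> M), derivation iota delta ->
    (exists f : {linear Omega -> M}, forall x : F, f (d x) = delta x) /\
    (forall f g : {linear Omega -> M},
       (forall x : F, f (d x) = g (d x)) -> f =1 g).

(* eta = x_{p-1} dt for some separating t and some decomposition
   omega = (x_0^p + x_1^p t + ... + x_{p-1}^p t^{p-1}) dt. *)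
Definition cartier_value (p : nat) (K F : fieldType)
    (iota : {rmorphism K -> F}) (Omega : lmodType F) (d : F -> Omega)
    (omega eta : Omega) : Prop :=
  exists (t : F) (x : nat -> F),
    [/\ separating iota t,
        omega = (\sum_(k < p) x k ^+ p * t ^+ k) *: d t
      & eta = x p.-1 *: d t].

(* The Cartier operator: the eta with cartier_value omega eta, which over a
   perfect field K of characteristic p exists and is independent of t and x.
   The default 0 of xget is therefore irrelevant. *)
Definition cartier (p : nat) (K F : fieldType) (iota : {rmorphism K -> F})
    (Omega : lmodType F) (d : F -> Omega) (omega : Omega) : Omega :=
  xget 0 [set eta | cartier_value p iota d omega eta]%classic.

(* F = K(X, Y) is the function field of X^{q+1} + Y^{q+1} + 1 = 0. *)
Definition hermitian_function_field (q : nat) (K F : fieldType)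
    (iota : {rmorphism K -> F}) (X Y : F) : Prop :=
  [/\ ~ algebraicOver iota X,
      X ^+ q.+1 + Y ^+ q.+1 + 1 = 0
    & forall z : F, in_adjoin iota [set X; Y]%classic z].

Definition herm_omega (q : nat) (F : fieldType) (Omega : lmodType F)
    (d : F -> Omega) (X Y : F) (i j : int) : Omega :=
  ((X ^ i * Y ^ j) / (X * Y * q.+1%:R * Y ^+ q)) *: d X.

Definition herm_ceil (p e : nat) (i : int) : int :=
  Num.ceil ((i * (p ^ e.-1)%N%:Z)%:Q / (p ^ e).+1%:R).

Definition herm_tilde (p e : nat) (i : int) : int :=
  (p ^ e).+1%:Z * herm_ceil p e i - i * (p ^ e.-1)%N%:Z.

(* Main.v *)
(* Write [q' = q / p] and let [frob] be the map [x |-> x^p].  The field F is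
   the free [F^p]-module on [1, X, ..., X^(p-1)]: it is spanned by the powers
   of X because [Y = - Y^(-q) (1 + X^q X)], and X is not a p-th power because a
   p-th root of X would be separable and purely inseparable over [K(X)], hence
   in [K(X)].  This gives the derivation [pderiv = d/dX], so that [dX <> 0], and
   the coordinate [pcoef] with [C(f dX) = pcoef f dX].  That the latter does not
   depend on X reduces to [C(t^k dt) = 0] for [k < p - 1] (exactness) and
   [C(t^(p-1) dt) = dt]; the set of t satisfying the last identity contains X
   and the p-th powers and is closed under products and under adding 1, hence
   is F.

   With [j - 1 = j1 p + j0], substituting the formula for Y in [Y^j0] writes
   [omega_{i,j}] as a sum over [l <= j0 < p] of p-th powers times
   ['C(j0, l) X^(i-1+l) dX], and only [l = -i mod p] contributes to C. *)

Require Import Defs.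
From HB Require Import structures.
From mathcomp Require Import all_boot all_order all_algebra all_field.
From mathcomp Require Import boolp classical_sets.
From mathcomp Require Import ring zify.

Set Implicit Arguments.
Unset Strict Implicit.
Unset Printing Implicit Defensive.

Import Order.TTheory GRing.Theory Num.Theory.
Local Open Scope ring_scope.

(** * Adjunction as a subfield *)

Section Adjoin.
Variables (K F : fieldType) (iota : {rmorphism K -> F}) (A : set F).

Definition adjoin : {pred F} := [pred z | `[< in_adjoin iota A z >]].

Lemma adjoinP z : reflect (in_adjoin iota A z) (z \in adjoin).
Proof. by rewrite inE; apply: asboolP. Qed.

Lemma adjoin_divring : divring_closed adjoin.
Proof.
split=> [|x y /adjoinP Ax /adjoinP Ay|x y /adjoinP Ax /adjoinP Ay];
  apply/adjoinP=> S closedS SK SA; case: (closedS) => S1 SB SV //.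
  by apply: SB; [apply: Ax | apply: Ay].
by apply: SV; [apply: Ax | apply: Ay].
Qed.
HB.instance Definition _ := GRing.isDivringClosed.Build F adjoin adjoin_divring.

Definition adjoin_field := {z | z \in adjoin}.
HB.instance Definition _ := SubChoice.on adjoin_field.
HB.instance Definition _ := [SubChoice_isSubIntegralDomain of adjoin_field by <:].
HB.instance Definition _ := [SubIntegralDomain_isSubField of adjoin_field by <:].

Lemma mem_adjoin a : A a -> in_adjoin iota A a.
Proof. by move=> Aa S _ _; apply. Qed.

Lemma in_adjoin_base c : in_adjoin iota A (iota c).
Proof. by move=> S _ + _; apply. Qed.

(** Polynomials with coefficients in [K(A)] thereby become images of polynomials over a field
    [E]. *)
Lemma adjoin_subfield :
  exists (E : fieldType) (phi : {rmorphism E -> F}),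
    forall z, in_adjoin iota A z <-> exists a, phi a = z.
Proof.
exists adjoin_field, (val : {rmorphism adjoin_field -> F}) => z; split.
  by move/adjoinP=> Az; exists (Sub z Az); apply: SubK.
by case=> a <-; apply/adjoinP; apply: valP.
Qed.

End Adjoin.

(** * Separable and purely inseparable elements over a subfield *)

(** Let [M] be the minimal polynomial of [y]. Separability is proved in a finite extension [L]
    generated by a root [y'] of [M]: if [z = R(y)] and [P] kills [R(y')], then [M] divides
    [P \Po R], so [P] kills [z]. *)
Lemma separable_simple_extension (E F : fieldType) (phi : {rmorphism E -> F})
    (Q : {poly E}) (y : F) :
    separable_poly Q -> root (map_poly phi Q) y ->
    (forall z, in_adjoin phi [set y]%classic z) ->
  forall z, exists2 P : {poly E}, separable_poly P & root (map_poly phi P) z.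
Proof.
move=> sepQ Qy genF z.
pose bad n := `[< exists2 M : {poly E}, size M = n &
                    M != 0 /\ root (map_poly phi M) y >].
have [n /asboolP[M szM [nzM My]] minM] : {n | bad n & forall m, bad m -> (n <= m)%N}.
  have exbad : exists n, bad n.
    by exists (size Q); apply/asboolP; exists Q; rewrite // separable_poly_neq0.
  by case: (ex_minnP exbad) => n; exists n.
have irrM : irreducible_poly M.
  apply/(subfx_irreducibleP My nzM) => R Ry nzR; rewrite szM.
  by apply: minM; apply/asboolP; exists R.
(* The target field varies because this serves for [y] in [F] and for [y'] in [L]. *)
have dvdM (E' : fieldType) (psi : {rmorphism E -> E'}) x R :
    root (map_poly psi M) x -> root (map_poly psi R) x -> M %| R.
  move=> Mx Rx; apply: contraT; rewrite -irreducible_poly_coprime // => copMR.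
  have: coprimep (map_poly psi M) (map_poly psi R) by rewrite coprimep_map.
  by move/coprimep_root/(_ Mx); rewrite (eqP Rx) eqxx.
have [L _ [y' My' genL]] := irredp_FAdjoin irrM.
(* Polynomials in [y] form a field: inverses come from Bezout relations with [M]. *)
have {z genF} [R ->] : exists R, z = (map_poly phi R).[y].
  pose S := [pred u | `[< exists R, u = (map_poly phi R).[y] >]].
  suffices : z \in S by rewrite inE.
  apply: (genF z S) => [|c|_ ->]; last 1 first.
  - by rewrite inE; exists 'X; rewrite map_polyX hornerX.
  - split=> [|u v|u v]; rewrite ?inE.
    + by exists 1; rewrite rmorph1 hornerC.
    + move=> [Ru ->] [Rv ->]; exists (Ru - Rv).
      by rewrite rmorphB hornerD hornerN.
    + move=> [Ru ->] [Rv ->].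
      have [->|nzv] := eqVneq (map_poly phi Rv).[y] 0.
        by exists 0; rewrite invr0 mulr0 rmorph0 horner0.
      have : coprimep M Rv.
        rewrite irreducible_poly_coprime //; apply: contra nzv => /dvdpP[T ->].
        by rewrite rmorphM hornerM (eqP My) mulr0.
      case/Bezout_eq1_coprimepP=> -[T1 T2] /= /(congr1 (fun T => (map_poly phi T).[y])).
      rewrite rmorphD !rmorphM rmorph1 hornerD !hornerM hornerC (eqP My) mulr0 add0r.
      move=> inv_v; exists (Ru * T2); rewrite rmorphM hornerM; congr (_ * _).
      by rewrite -[RHS](mulfK nzv) inv_v mul1r.
  - by rewrite inE; exists c%:P; rewrite map_polyC hornerC.
pose w := (map_poly (GRing.in_alg L) R).[y'].
have: separable_element 1 w.
  have: separable_element 1 y'.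
    apply/separable_elementP; exists (map_poly (GRing.in_alg L) M); split=> //.
      by apply/polyOverP=> k; rewrite coef_map rpredZ ?rpred1.
    by rewrite separable_map (dvdp_separable (dvdM _ _ _ _ My Qy)).
  by move/adjoin_separableP; apply; rewrite genL memvf.
case/separable_elementP=> f [/polyOver1P[P ->{f}] Pw].
rewrite separable_map => sepP; exists P => //.
have /dvdpP[S defPR]: M %| P \Po R.
  by apply: dvdM My' _; rewrite map_comp_poly rootE horner_comp.
rewrite rootE -horner_comp -map_comp_poly defPR rmorphM hornerM.
by rewrite (eqP My) mulr0.
Qed.

(* In the factorization of the gcd of P and T^p - a over F only T - x occurs,
   so its second coefficient is a multiple of x by an integer prime to p. *)
Lemma root_in_subfield (p : nat) (E F : fieldType) (phi : {rmorphism E -> F})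
    (P : {poly E}) (a : E) (x : F) :
    p \in [pchar F] -> root (map_poly phi P) x -> phi a = x ^+ p ->
    ~~ (('X - x%:P) ^+ p %| map_poly phi P) ->
  exists b, phi b = x.
Proof.
move=> pcharF Px phia ndvd.
have pcharP : p \in [pchar {poly F}] by rewrite pchar_poly.
have p_gt0 := prime_gt0 (pcharf_prime pcharF).
pose N := 'X^p - a%:P; pose G := gcdp P N.
have mapN : map_poly phi N = ('X - x%:P) ^+ p.
  rewrite rmorphB /= map_polyXn map_polyC /= phia -!(pFrobenius_autE pcharP).
  by rewrite pFrobenius_autB_comm ?polyC_exp //; apply: mulrC.
have mapG : map_poly phi G %| ('X - x%:P) ^+ p.
  by rewrite -mapN dvdp_map dvdp_gcdr.
have Gx : root (map_poly phi G) x.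
  by rewrite gcdp_map root_gcd Px mapN rootE !hornerE subrr expr0n gtn_eqF.
have [m le_mp eqG] := dvdp_exp_XsubCP mapG.
(* [m] is positive because [x] is a common root, and below [p] because [(T - x)^p] does not divide
   [P]; hence it is invertible in [F]. *)
have m_gt0 : (0 < m)%N.
  case: m eqG {le_mp} => // eqG; have:= Gx.
  by rewrite (eqp_root eqG) rootE hornerC oner_eq0.
have lt_mp : (m < p)%N.
  rewrite ltn_neqAle le_mp andbT; apply: contra ndvd => /eqP <-.
  by rewrite -(eqp_dvdl _ eqG) dvdp_map dvdp_gcdl.
have [[c1 c2] /= /andP[nz1 nz2]] := eqpP _ _ eqG.
move=> /polyP eqc.
have szm : size (('X - x%:P) ^+ m) = m.+1 by rewrite size_exp_XsubC.
have:= eqc m; have:= eqc m.-1; rewrite !coefZ !coef_map /=.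
have -> : (('X - x%:P) ^+ m)`_m = 1.
  have /monicP := monic_exp m (monicXsubC x).
  by rewrite lead_coefE szm.
have -> : (('X - x%:P) ^+ m)`_m.-1 = - (x *+ m).
  have := @coefPn_prod_XsubC _ (nseq m x); rewrite size_nseq -lt0n => /(_ m_gt0).
  by rewrite !big_nseq iter_mulr_1 iter_addr_0.
move=> eq1 eq2; exists (- (G`_m.-1 / G`_m / m%:R)).
have nzm : m%:R != 0 :> F by rewrite -(dvdn_pcharf pcharF) gtnNdvd.
have nzGm : phi G`_m != 0.
  by apply: contraNneq nz2 => z0; rewrite z0 mulr0 mulr1 in eq2; rewrite -eq2.
rewrite rmorphN !fmorph_div rmorph_nat.
have -> : phi G`_m.-1 = - (x *+ m) * phi G`_m.
  apply: (mulfI nz1); rewrite eq1 mulrCA eq2 mulr1 mulrC //.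
by rewrite (mulfK nzGm) mulNr opprK -[x *+ m]mulr_natr (mulfK nzm).
Qed.

(** * Coordinates and derivation for the p-basis X *)

Section PBasis.
Variables (p : nat) (F : fieldType) (pcharF : p \in [pchar F]) (X : F).
Variable frob : {rmorphism F -> F}.
Hypothesis frobE : forall x, frob x = x ^+ p.
Hypothesis X_npower : forall w, frob w != X.
Hypothesis X_span : forall z, exists A : {poly F}, (map_poly frob A).[X] == z.

(** A ring morphism presenting [F] as [F[T]/(N)]: [frob] turns [N] into [T^p - X^p], which vanishes
    at [X]. *)
Let ev (A : {poly F}) := (map_poly frob A).[X].
Let N : {poly F} := 'X^p - X%:P.
Let p_prime : prime p := pcharf_prime pcharF.
Let p_gt0 : (0 < p)%N := prime_gt0 p_prime.
Let szN : size N = p.+1. Proof. exact: size_XnsubC. Qed.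

Let evN : ev N = 0.
Proof. by rewrite /ev rmorphB /= map_polyXn map_polyC !hornerE /= frobE subrr. Qed.

(** View [F] as an extension of itself through [frob]. A nonzero remainder modulo [N] has degree
    below [p], so [(T - X)^p] cannot divide its image; a root at [X] would then make [X] a p-th
    power. *)
Lemma ev_eq0 A : ev A = 0 -> N %| A.
Proof.
move=> evA; have evR : ev (A %% N) = 0.
  move: evA; rewrite {1}(divp_eq A N) /ev rmorphD rmorphM /= hornerD hornerM.
  by rewrite -/(ev N) evN mulr0 add0r.
have szR : (size (A %% N)%R <= p)%N.
  by rewrite -ltnS -szN ltn_modp -size_poly_gt0 szN.
apply: contraT => nzR; rewrite /dvdp in nzR.
have [|||b defX] := @root_in_subfield p F F frob (A %% N) X X pcharF.
- exact/eqP.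
- by rewrite frobE.
- apply: contraL szR => /dvdp_leq; rewrite map_poly_eq0 => /(_ nzR).
  by rewrite size_exp_XsubC size_map_poly -ltnNge.
by have := X_npower b; rewrite defX eqxx.
Qed.

Let lift z : {poly F} := xchoose (X_span z).
Let liftK z : ev (lift z) = z. Proof. exact/eqP/(xchooseP (X_span z)). Qed.
(** Modulo [N] the choice made by [lift] is immaterial. *)
Let lift_ev A : N %| lift (ev A) - A.
Proof.
by apply: ev_eq0; rewrite /ev rmorphB hornerD hornerN -!/(ev _) liftK subrr.
Qed.

(* [lift z] holds p-th roots of the coordinates of z, so [pcoef] needs no
   further root. *)
Definition pderiv z := ev (lift z)^`().
Definition pcoef z := (lift z %% N)`_p.-1.

(** The formal derivative respects congruence modulo [N], because [N' = p T^(p-1) = 0]. *)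
Lemma pderiv_ev A : pderiv (ev A) = ev A^`().
Proof.
have pcharP : p \in [pchar {poly F}] by rewrite pchar_poly.
apply/eqP; rewrite -subr_eq0 /pderiv /ev -hornerN -hornerD -rmorphN -rmorphD /=.
rewrite -derivN -derivD; have /dvdpP[M ->] := lift_ev A.
rewrite derivM derivB derivXn derivC subr0 -mulr_natr (pcharf0 pcharP).
by rewrite !mulr0 addr0 rmorphM hornerM -/(ev N) evN mulr0.
Qed.

Lemma pcoef_ev A : pcoef (ev A) = (A %% N)`_p.-1.
Proof.
rewrite /pcoef; congr (_ : {poly F})`_ _; apply/eqP.
by rewrite -subr_eq0 -modpN -modpD; apply: lift_ev.
Qed.

Let evD A B : ev (A + B) = ev A + ev B.
Proof. by rewrite /ev rmorphD hornerD. Qed.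

Let evM A B : ev (A * B) = ev A * ev B.
Proof. by rewrite /ev rmorphM hornerM. Qed.

Let evC a : ev a%:P = frob a.
Proof. by rewrite /ev map_polyC hornerC. Qed.

Let evX : ev 'X = X.
Proof. by rewrite /ev map_polyX hornerX. Qed.

Let small z : exists2 A : {poly F}, (size A <= p)%N & ev A = z.
Proof.
exists (lift z %% N); first by rewrite -ltnS -szN ltn_modp -size_poly_gt0 szN.
rewrite -[RHS]liftK [in RHS](divp_eq (lift z) N).
by rewrite evD evM evN mulr0 add0r.
Qed.

Lemma pcoef_small (A : {poly F}) : (size A <= p)%N -> pcoef (ev A) = A`_p.-1.
Proof. by move=> szA; rewrite pcoef_ev modp_small // szN ltnS. Qed.

Lemma pcoefD : {morph pcoef : x y / x + y}.
Proof. by move=> x y; rewrite -[x]liftK -[y]liftK -evD !pcoef_ev modpD coefD. Qed.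

Lemma pcoefZ a z : pcoef (frob a * z) = a * pcoef z.
Proof.
rewrite -[z]liftK -evC -evM mul_polyC !pcoef_ev.
by rewrite modpZl coefZ.
Qed.

Lemma pcoef_sum (I : finType) (f : I -> F) :
  pcoef (\sum_i f i) = \sum_i pcoef (f i).
Proof.
apply: (big_morph _ pcoefD).
by have := pcoefZ 0 0; rewrite mul0r mulr0.
Qed.

Lemma pderivD : {morph pderiv : x y / x + y}.
Proof. by move=> x y; rewrite -[x]liftK -[y]liftK -evD !pderiv_ev derivD evD. Qed.

Lemma pderivM x y : pderiv (x * y) = x * pderiv y + y * pderiv x.
Proof.
rewrite -[x]liftK -[y]liftK -evM !pderiv_ev derivM evD !evM.
by rewrite addrC mulrC [ev _^`() * _]mulrC mulrC.
Qed.

Lemma pderiv_frob a : pderiv (frob a) = 0.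
Proof. by rewrite -evC pderiv_ev derivC evC rmorph0. Qed.

Lemma pderivX : pderiv X = 1.
Proof. by rewrite -evX pderiv_ev derivX evC rmorph1. Qed.

Lemma pderiv_exp z n : pderiv (z ^+ n.+1) = n.+1%:R * z ^+ n * pderiv z.
Proof.
elim: n => [|n IHn]; first by rewrite mulr1 mul1r.
rewrite exprS pderivM IHn [n.+2%:R]mulrSr mulrDl mul1r mulrDl exprS; congr (_ + _).
by rewrite !mulrA [_ * n.+1%:R]mulrC.
Qed.

(** The coefficient of [T^(p-1)] in [A'] is [p] times that of [T^p] in [A]. *)
Lemma pcoef_pderiv z : pcoef (pderiv z) = 0.
Proof.
have [A szA <-] := small z.
have szA' : (size A^`() <= p)%N.
  by apply: leq_trans (size_poly _ _) (leq_trans (leq_pred _) szA).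
rewrite pderiv_ev pcoef_small // coef_deriv prednK // -mulr_natr.
by rewrite (pcharf0 pcharF) mulr0.
Qed.

Lemma pcoef_exp_pderiv t k : (k < p.-1)%N -> pcoef (t ^+ k * pderiv t) = 0.
Proof.
move=> lt_kp; have nz : k.+1%:R != 0 :> F.
  by rewrite -(dvdn_pcharf pcharF) gtnNdvd // -(prednK p_gt0).
(* The constant [1/(k+1)] lies in the prime field, so it is its own image under [frob] and leaves
   [pcoef] by [pcoefZ]. *)
have -> : t ^+ k * pderiv t = frob k.+1%:R^-1 * pderiv (t ^+ k.+1).
  by rewrite pderiv_exp fmorphV rmorph_nat !mulrA mulVf // mul1r.
by rewrite pcoefZ pcoef_pderiv mulr0.
Qed.

(* Cartier's identity C(t^(p-1) dt) = dt, i.e. invariance of dt/t. *)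
Let inv_log t := pcoef (t ^+ p.-1 * pderiv t) = pderiv t.

(** This is additivity of [dt/t], multiplied by the p-th power [(st)^p]. *)
Let inv_logM s t : inv_log s -> inv_log t -> inv_log (s * t).
Proof.
rewrite /inv_log => Ls Lt; rewrite pderivM.
have expS z : z ^+ p.-1 * z = frob z by rewrite -exprSr prednK // frobE.
have -> : (s * t) ^+ p.-1 * (s * pderiv t + t * pderiv s) =
    frob s * (t ^+ p.-1 * pderiv t) + frob t * (s ^+ p.-1 * pderiv s).
  by rewrite -!expS exprMn; ring.
by rewrite pcoefD !pcoefZ Ls Lt.
Qed.

Let inv_log_frob a : inv_log (frob a).
Proof.
by rewrite /inv_log pderiv_frob mulr0; have := pcoefZ 0 0; rewrite mul0r mulr0.
Qed.

Let inv_logX : inv_log X.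
Proof.
rewrite /inv_log pderivX mulr1.
have -> : X ^+ p.-1 = ev 'X^(p.-1) by rewrite /ev map_polyXn hornerXn.
by rewrite pcoef_small ?size_polyXn ?prednK // coefXn eqxx.
Qed.

(** In the expansion of [(t+1)^(p-1) dt] every term below the top one is exact. *)
Let inv_logD1 t : inv_log t -> inv_log (t + 1).
Proof.
rewrite /inv_log => Lt; have D1 : pderiv 1 = 0 by rewrite -(rmorph1 frob) pderiv_frob.
rewrite pderivD D1 addr0 exprD1n mulr_suml pcoef_sum big_ord_recr /=.
rewrite big1 ?add0r ?binn // => k _.
by rewrite -mulr_natl -mulrA -(rmorph_nat frob) pcoefZ pcoef_exp_pderiv ?mulr0.
Qed.

Lemma pcoef_exp_pred_pderiv t : pcoef (t ^+ p.-1 * pderiv t) = pderiv t.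
Proof.
rewrite -[t]liftK -/(inv_log _).
elim/poly_ind: (lift t) => [|A c IH]; first by rewrite -polyC0 evC.
have [->|nzc] := eqVneq c 0; first by rewrite addr0 evM evX; apply: inv_logM.
(* Scaling the constant term to 1 by a p-th power reduces each Horner step to [inv_logM] and
   [inv_logD1]. *)
have -> : ev (A * 'X + c%:P) = (ev (A * 'X) * frob c^-1 + 1) * frob c.
  by rewrite evD evC fmorphV mulrDl mulfVK ?fmorph_eq0 // mul1r.
apply/inv_logM/inv_log_frob/inv_logD1/inv_logM/inv_log_frob.
by rewrite evM evX; apply: inv_logM.
Qed.

Lemma pcoef_expX_pred m : pcoef (X ^+ (m * p + p.-1)) = X ^+ m.
Proof.
have := pcoef_exp_pred_pderiv X; rewrite pderivX mulr1 => C1.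
by rewrite exprD exprM -frobE pcoefZ C1 mulr1.
Qed.

Lemma pcoef_expX_eq0 m : ~~ (p %| m.+1)%N -> pcoef (X ^+ m) = 0.
Proof.
move=> ndiv; rewrite (divn_eq m p) exprD exprM -frobE pcoefZ.
rewrite -[X ^+ (m %% p)]mulr1 -pderivX pcoef_exp_pderiv ?mulr0 //.
have := ltn_pmod m p_gt0; rewrite -{2}(prednK p_gt0) ltnS leq_eqVlt.
case/predU1P=> // mp; case/negP: ndiv.
by rewrite (divn_eq m p) mp -addnS prednK // dvdn_add ?dvdn_mull.
Qed.

(** * Differentials and the Cartier operator *)

Section Differentials.
Variables (K : fieldType) (iota : {rmorphism K -> F}).
Hypothesis iota_frob : forall c, exists a, frob a = iota c.
Variables (Omega : lmodType F) (d : F -> Omega).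
Hypothesis Omega_d : differential_module iota d.

(** The universal property, applied to [pderiv], yields a linear map sending [d X] to 1. *)
Lemma dX_neq0 : d X != 0.
Proof.
have [_ /(_ F^o pderiv) []] := Omega_d.
  split=> [x y|x y|c]; first exact: pderivD; first exact: pderivM.
  by have [a <-] := iota_frob c; apply: pderiv_frob.
case=> f fd _; apply/eqP=> dX0; have:= fd X.
by rewrite dX0 linear0 pderivX => /esym/eqP; rewrite oner_eq0.
Qed.

Lemma d_pderiv z : d z = pderiv z *: d X.
Proof.
have [[dD dM _] _] := Omega_d.
have d1 : d 1 = 0.
  by apply: (addrI (d 1)); rewrite addr0 -[in RHS](mulr1 1) dM scale1r.
have d_exp a n : d (a ^+ n) = (n%:R * a ^+ n.-1) *: d a.
  elim: n => [|n IHn]; first by rewrite mul0r scale0r.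
  rewrite exprS dM IHn scalerA -scalerDl /= mulrSr mulrDl mul1r addrC; congr (_ *: _).
  case: n {IHn} => [|n]; first by rewrite !mul0r mulr0 addrC.
  by rewrite exprS mulrCA addrC.
have d_frob a : d (frob a) = 0 by rewrite frobE d_exp (pcharf0 pcharF) mul0r scale0r.
rewrite -[z]liftK; elim/poly_ind: (lift z) => [|A c IH].
  by rewrite -polyC0 evC d_frob pderiv_frob scale0r.
rewrite evD evM evC evX dD pderivD d_frob pderiv_frob dM IH !addr0 pderivM pderivX.
by rewrite mulr1 scalerDl scalerA addrC.
Qed.

(** A value exists by taking [t = X] and the coordinates of [f]. For any other decomposition, cancel
    [d X] and apply [pcoef] termwise: only the term in [t^(p-1)] survives. *)
Lemma cartier_dX f :
  separating iota X -> cartier p iota d (f *: d X) = pcoef f *: d X.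
Proof.
move=> sepX; apply: xget_unique.
  have [A szA <-] := small f; exists X, (fun k => A`_k); split=> //.
    congr (_ *: _); rewrite /ev (horner_coef_wide _ (_ : size _ <= p)%N); last first.
      by rewrite size_map_poly.
    by apply: eq_bigr => k _; rewrite coef_map /= frobE.
  by rewrite pcoef_small.
move=> eta [t [x [_ + ->]]].
rewrite [d t]d_pderiv !scalerA => /eqP.
rewrite -subr_eq0 -scalerBl scaler_eq0 (negPf dX_neq0) orbF subr_eq0 => /eqP ->.
congr (_ *: _); rewrite mulr_suml pcoef_sum -(prednK p_gt0) big_ord_recr /=.
rewrite big1 ?add0r => [|k _]; rewrite -mulrA (prednK p_gt0) -frobE pcoefZ.
  by rewrite pcoef_exp_pred_pderiv.
by rewrite pcoef_exp_pderiv ?mulr0.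
Qed.

End Differentials.
End PBasis.

(** * Rational functions in X *)

Lemma in_adjoin1_ratio (K F : fieldType) (iota : {rmorphism K -> F}) (X z : F) :
    in_adjoin iota [set X]%classic z ->
  exists f g : {poly K}, (map_poly iota g).[X] != 0 /\
    z = (map_poly iota f).[X] / (map_poly iota g).[X].
Proof.
set ev := fun f : {poly K} => (map_poly iota f).[X].
have evM f g : ev (f * g) = ev f * ev g by rewrite /ev rmorphM hornerM.
have evB f g : ev (f - g) = ev f - ev g by rewrite /ev rmorphB hornerD hornerN.
have ev1 : ev 1 = 1 by rewrite /ev rmorph1 hornerC.
pose S := [pred u | `[< exists f g, ev g != 0 /\ u = ev f / ev g >]].
move=> Xz; suffices : z \in S by rewrite inE.
apply: (Xz S) => [|c|_ ->].
- split=> [|u v|u v]; rewrite ?inE.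
  + by exists 1, 1; rewrite ev1 divr1 oner_neq0.
  + move=> [f [g [nzg ->]]] [f' [g' [nzg' ->]]].
    exists (f * g' - f' * g), (g * g').
    by rewrite evB !evM mulf_neq0 //; split=> //; field; apply/andP.
  + move=> [f [g [nzg ->]]] [f' [g' [nzg' ->]]].
    have [f'0|nzf'] := eqVneq (ev f') 0.
      exists 0, 1; rewrite f'0 mul0r invr0 mulr0 ev1 oner_neq0.
      by rewrite /ev rmorph0 horner0 mul0r.
    exists (f * g'), (g * f').
    by rewrite !evM mulf_neq0 //; split=> //; field; apply/and3P.
- by rewrite inE; exists c%:P, 1; rewrite ev1 divr1 oner_neq0 /ev map_polyC hornerC.
- by rewrite inE; exists 'X, 1; rewrite ev1 divr1 oner_neq0 /ev map_polyX hornerX.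
Qed.

(** By transcendence [(f/g)^p = X] gives [f^p = T g^p] in [K[T]], where the degrees disagree modulo
    [p]. *)
Lemma transcendental_npower (p : nat) (K F : fieldType)
    (iota : {rmorphism K -> F}) (X w : F) :
    (1 < p)%N -> ~ algebraicOver iota X -> in_adjoin iota [set X]%classic w ->
  w ^+ p != X.
Proof.
move=> p_gt1 trX /in_adjoin1_ratio[f [g [nzg ->]]]; apply/eqP=> defX.
have ev_inj (h : {poly K}) : root (map_poly iota h) X -> h = 0.
  by move=> hX; apply: contra_notP trX => /eqP nzh; exists h.
have nz_g : g != 0 by apply: contraNneq nzg => ->; rewrite rmorph0 horner0.
have /eqP : f ^+ p - 'X * g ^+ p = 0.
  apply: ev_inj; rewrite rootE rmorphB rmorphM !rmorphXn /= map_polyX.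
  rewrite !hornerE -[X in X - _](mulfVK (_ : (map_poly iota g).[X] ^+ p != 0)).
    by rewrite -expr_div_n defX subrr.
  by rewrite expf_neq0.
rewrite subr_eq0 => /eqP eqfg.
have nz_f : f != 0.
  apply/eqP=> f0; have /eqP := eqfg; rewrite f0 expr0n gtn_eqF ?(ltnW p_gt1) //.
  by rewrite eq_sym mulf_eq0 polyX_eq0 expf_eq0 (negPf nz_g) andbF.
have := congr1 (fun h : {poly K} => (size h).-1) eqfg.
rewrite [in RHS]mulrC size_mulX ?expf_neq0 //= !size_exp => eqs.
have : ((size f).-1 * p = ((size g).-1 * p).+1)%N.
  by rewrite eqs -size_exp -polySpred ?expf_neq0.
move/(congr1 (modn^~ p)); rewrite modnMl -addn1 modnMDl modn_small //.
Qed.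

(** * The Hermitian function field *)

Section Hermitian.
Variables (p e : nat) (K F : fieldType) (iota : {rmorphism K -> F}) (X Y : F).
Hypothesis pcharF : p \in [pchar F].
Hypothesis e_gt0 : (0 < e)%N.
Hypothesis herm_F : hermitian_function_field (p ^ e)%N iota X Y.
Variable frob : {rmorphism F -> F}.
Hypothesis frobE : forall x, frob x = x ^+ p.
Hypothesis iota_frob : forall c, exists a, frob a = iota c.

Let p_prime : prime p := pcharf_prime pcharF.
Let p_gt0 : (0 < p)%N := prime_gt0 p_prime.
Let q_eq : (p ^ e = p ^ e.-1 * p)%N.
Proof. by rewrite -expnSr prednK. Qed.

Lemma herm_XYneq0 : X != 0 /\ Y != 0.
Proof.
have [trX eqXY _] := herm_F; split; apply/eqP=> z0; case: trX.
  by exists 'X; rewrite ?polyX_eq0 // map_polyX z0 rootX.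
exists ('X^((p ^ e).+1) + 1%:P); first by rewrite -size_poly_eq0 size_XnaddC.
rewrite rmorphD /= map_polyXn map_polyC /= rmorph1 rootE !hornerE.
by move: eqXY; rewrite z0 expr0n addr0 => ->.
Qed.

(** Divide the curve equation by [Y^q]; as [q = q'p], both [Y^(-q)] and [X^q] are p-th powers. *)
Lemma herm_YE : Y = frob (- (Y ^- (p ^ e.-1))) * (1 + frob (X ^+ (p ^ e.-1)) * X).
Proof.
have [_ eqXY _] := herm_F; have [_ nzY] := herm_XYneq0.
rewrite rmorphN fmorphV !frobE -!exprM -q_eq -exprSr.
have -> : 1 + X ^+ (p ^ e).+1 = - Y ^+ (p ^ e).+1.
  by apply/eqP; rewrite -addr_eq0 -addrA addrC -eqXY; apply/eqP; ring.
by rewrite mulrNN exprS mulrC mulfK ?expf_neq0.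
Qed.

(** The ring [F^p[X]] contains [K], [X] and [Y], and it is a field since [1/b = b^(p-1) (1/b)^p]. *)
Lemma herm_span z : exists A : {poly F}, (map_poly frob A).[X] == z.
Proof.
pose ev A := (map_poly frob A).[X].
have evM A B : ev (A * B) = ev A * ev B by rewrite /ev rmorphM hornerM.
have evC a : ev a%:P = frob a by rewrite /ev map_polyC hornerC.
pose S := [pred u | `[< exists A, ev A = u >]].
have [_ _ genF] := herm_F.
suffices : z \in S by rewrite inE => -[A <-]; exists A.
have expS n A B : ev A ^+ n * ev B = ev (A ^+ n * B).
  rewrite evM; congr (_ * _); elim: n => [|n IHn].
    by rewrite !expr0 /ev rmorph1 hornerC.
  by rewrite !exprS evM IHn.
apply: (genF z S) => [|c|_ [->|->]]; rewrite ?inE.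
- split=> [|u v|u v]; rewrite ?inE.
  + by exists 1; rewrite /ev rmorph1 hornerC.
  + by move=> [A <-] [B <-]; exists (A - B); rewrite /ev rmorphB hornerD hornerN.
  + move=> [A <-] [B <-].
    have [->|nzB] := eqVneq (ev B) 0.
      by exists 0; rewrite invr0 mulr0 /ev rmorph0 horner0.
    exists (A * (B ^+ p.-1 * (ev B)^-1%:P)); rewrite evM -expS evC; congr (_ * _).
    rewrite fmorphV frobE -[in X in X^-1](prednK p_gt0) exprSr invfM.
    by rewrite mulrA mulfV ?mul1r ?expf_neq0.
- by have [a <-] := iota_frob c; exists a%:P.
- by exists 'X; rewrite /ev map_polyX hornerX.
- exists ((- (Y ^- (p ^ e.-1)))%:P * (1 + (X ^+ (p ^ e.-1))%:P * 'X)).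
  rewrite [RHS]herm_YE evM evC /ev rmorphD rmorphM rmorph1 /=.
  by rewrite map_polyC map_polyX !hornerE.
Qed.

(** Over [K(X)], [Y] is a root of [Q = T^(q+1) + X^(q+1) + 1]; here [Q' = T^q] is prime to [Q]
    because [Q(0) = -Y^(q+1)] is nonzero. *)
Lemma herm_separating : separating iota X.
Proof.
have [_ eqXY genF] := herm_F; have [nzX nzY] := herm_XYneq0.
have [E [phi phiP]] := adjoin_subfield iota [set X]%classic.
have [x phix] : exists x, phi x = X by apply/phiP/mem_adjoin.
pose Q := 'X^((p ^ e).+1) + (x ^+ (p ^ e).+1 + 1)%:P.
have sepQ : separable_poly Q.
  rewrite separable_poly.unlock /Q derivD derivXn derivC addr0 -mulr_natr.
  have -> : (p ^ e).+1%:R = 1 :> {poly E}.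
    have pcharE : p \in [pchar {poly E}] by rewrite pchar_poly -(fmorph_pchar phi).
    by rewrite q_eq mulrSr natrM (pcharf0 pcharE) mulr0 add0r.
  rewrite mulr1 coprimep_expr // -[X in coprimep _ X]subr0 -polyC0 coprimep_XsubC.
  rewrite rootE !hornerE expr0n /= add0r -(fmorph_eq0 phi).
  rewrite rmorphD rmorphXn rmorph1 /= phix.
  apply: contraNneq nzY => z0; move: eqXY; rewrite addrAC z0 add0r => /eqP.
  by rewrite expf_eq0.
have Qy : root (map_poly phi Q) Y.
  rewrite rmorphD /= map_polyXn map_polyC /= rmorphD rmorphXn rmorph1 /= phix.
  by apply/eqP; rewrite !hornerE -[RHS]eqXY /=; ring.
move=> z; have [|P sepP Pz] := @separable_simple_extension E F phi Q Y sepQ Qy _ z.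
  move=> u S closedS phiS YS; apply: (genF u S closedS) => [c|_ [->|->]].
  - by have [a <-] : exists a, phi a = iota c by apply/phiP/in_adjoin_base.
  - by rewrite -phix.
  - exact: YS.
exists (map_poly phi P); split=> //; first by rewrite separable_map.
by move=> k; apply/phiP; exists P`_k; rewrite coef_map.
Qed.

Lemma herm_npower w : frob w != X.
Proof.
have [trX _ _] := herm_F; apply/eqP=> defX.
suff Xw : in_adjoin iota [set X]%classic w.
  have := transcendental_npower (prime_gt1 p_prime) trX Xw.
  by rewrite -frobE defX eqxx.
have [P [sepP Pw PX]] := herm_separating w.
have [E [phi phiP]] := adjoin_subfield iota [set X]%classic.
have [x phix] : exists x, phi x = X by apply/phiP/mem_adjoin.
(* Lift the coefficients of [P] from [K(X)] to [E], as [root_in_subfield] requires. *)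
have [R defP] : exists R, P = map_poly phi R.
  have [f fP] := choice (fun k => (phiP P`_k).1 (PX k)).
  exists (\poly_(k < size P) f k); apply/polyP=> k; rewrite coef_map coef_poly.
  by case: ltnP => [_|lePk] /=; [rewrite fP | rewrite rmorph0 nth_default].
apply/phiP; apply: (@root_in_subfield p E F phi R x) => //; first by rewrite -defP.
  by rewrite phix -frobE.
by rewrite -defP separable_nosquare ?prime_gt1 // size_XsubC.
Qed.
(** The exponents [i] and [j1 * p + j0] are the indices of the form lowered by one, so [k] is the
    residue of minus the first index and [c.+1] is that index divided by [p], rounded up. *)
Lemma herm_pcoef (i k j0 j1 c : nat) :
    (k < p)%N -> (j0 < p)%N -> (i.+1 + k = c.+1 * p)%N ->
  pcoef p herm_span (X ^+ i * Y ^+ (j1 * p + j0) / Y ^+ (p ^ e)) =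
  (-1) ^+ j0 * 'C(j0, k)%:R *
    (X ^+ (p ^ e.-1 * k + c) * (Y ^+ j1 / Y ^+ (p ^ e.-1 * j0.+1))).
Proof.
set q' := (p ^ e.-1)%N => lt_kp lt_jp eq_ik.
have C0 := pcoefD pcharF frobE herm_npower herm_span.
have CZ := pcoefZ pcharF frobE herm_npower herm_span.
have Csum := pcoef_sum pcharF frobE herm_npower herm_span.
have CX := pcoef_expX_pred pcharF frobE herm_npower herm_span.
have CX0 := pcoef_expX_eq0 pcharF frobE herm_npower herm_span.
(* Only [Y^j0] is expanded, by [herm_YE] and the binomial theorem; [Y^(j1 p)] and [Y^(-q)] are
   already p-th powers. *)
have -> : X ^+ i * Y ^+ (j1 * p + j0) / Y ^+ (p ^ e) =
    \sum_(l < j0.+1) frob (Y ^+ j1 / Y ^+ q' * (- Y ^- q') ^+ j0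
       * (X ^+ (q' * l) *+ 'C(j0, l))) * X ^+ (i + l).
  rewrite exprD exprM q_eq exprM -/q' -!frobE [in Y ^+ j0]herm_YE exprMn addrC exprD1n.
  rewrite !mulr_sumr mulr_suml; apply: eq_bigr => l _.
  rewrite -/q' exprM exprMn exprD.
  move: (X ^+ q') (Y ^+ q') (Y ^+ j1) => u v y.
  rewrite !rmorphM (rmorphXn _ j0) rmorphMn (rmorphXn _ l) fmorphV /=.
  move: (X ^+ i) (X ^+ l) (frob y) (frob _ ^+ j0) (frob u ^+ l) => a b y' w u'.
  by move: (frob v)^-1 => v'; rewrite !(mulrnAr, mulrnAl); congr (_ *+ _); ring.
rewrite Csum.
(* If [p] divided [i + l + 1], then [l] and [k], both below [p], would be congruent. *)
have Cl (l : 'I_j0.+1) : l != k :> nat -> pcoef p herm_span (X ^+ (i + l)) = 0.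
  move=> neq_lk; apply: CX0; apply: contra neq_lk => div_l.
  have := dvdn_mull c.+1 (dvdnn p); rewrite -eq_ik.
  move: div_l; rewrite -addSn; case/dvdnP=> a ea /dvdnP[b eb].
  have ltl : (l < p)%N by apply: leq_ltn_trans lt_jp; rewrite -ltnS.
  rewrite -(modn_small ltl) -(modn_small lt_kp) -(eqn_modDl i.+1) ea eb.
  by rewrite !modnMl.
(* When [j0 < k] the surviving index is out of range, and the binomial vanishes as well. *)
have [lt_jk|le_kj] := ltnP j0 k.
  rewrite bin_small // mulr0 mul0r big1 // => l _; rewrite CZ Cl ?mulr0 //.
  by rewrite neq_ltn (leq_ltn_trans _ lt_jk) // -ltnS.
rewrite (bigD1 (Ordinal (le_kj : (k < j0.+1)%N))) //= big1 ?addr0 => [|l neq_l].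
  have -> : (i + k = c * p + p.-1)%N by lia.
  rewrite CZ CX (exprNn (Y ^- q')) -[_ *+ 'C(_, _)]mulr_natr exprVn -exprM.
  rewrite mulnS !exprD invfM.
  move: ('C(j0, k)%:R) (X ^+ _) (X ^+ c) (Y ^+ j1) (Y ^- q') (Y ^- _) ((-1) ^+ j0).
  by move=> *; ring.
by rewrite CZ Cl ?mulr0.
Qed.
End Hermitian.

(** * Ceilings, residues and binomials modulo p *)

(** For [0 < i <= q] the fraction [i q'/(q+1)] lies just below [i q'/q = i/p] and has the same
    ceiling. *)
Lemma herm_ceil_nat (p e i c : nat) :
    (0 < e)%N -> (0 < i <= p ^ e)%N -> (i <= c * p < i + p)%N ->
  herm_ceil p e i = c.
Proof.
move=> e_gt0 /andP[i_gt0 le_iq] /andP[le_ic lt_ci]; apply: ceil_def.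
have q_eq : (p ^ e = p ^ e.-1 * p)%N by rewrite -expnSr prednK.
move: (p ^ e.-1)%N q_eq => q' q_eq.
have q_gt0 : 0 < (p ^ e).+1%:R :> rat by rewrite ltr0n.
case: c le_ic lt_ci => [|c] le_ic lt_ci; first by lia.
rewrite ltr_pdivlMr // ler_pdivrMr // -[(p ^ e).+1%:R]/((p ^ e).+1%:Z%:~R).
rewrite -!intrM ltr_int ler_int q_eq; apply/andP; split; last first.
  by have := leq_mul le_ic (leqnn q'); lia.
(* From [cp + 1 <= i] one gets [cq + q' <= i q'], and [c < q'] then gives [c(q+1) < i q']. *)
have lt_ci' : (c * p < i)%N by lia.
have lt_cq : (c < q')%N by nia.
have := leq_mul lt_ci' (leqnn q'); rewrite mulSn mulnAC -mulnA => le_cq.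
have -> : (c.+1%:Z - 1 = c%:Z) by lia.
by lia.
Qed.

Lemma prime_dvd_fact (p n : nat) : prime p -> (p %| n`!)%N = (p <= n)%N.
Proof.
move=> p_pr; elim: n => [|n IHn].
  by rewrite fact0 dvdn1 leqn0 -[RHS]negbK -lt0n prime_gt0 // gtn_eqF ?prime_gt1.
rewrite factS Euclid_dvdM // IHn; case: (ltngtP p n.+1) => [lt_pn|lt_np|->].
- by rewrite -ltnS lt_pn orbT.
- by rewrite gtnNdvd //= leqNgt (ltn_trans _ lt_np).
- by rewrite dvdnn.
Qed.

(** For [k <= n] the binomial divides [n!], which is prime to [p]. *)
Lemma bin_pchar_eq0 (p : nat) (R : nzRingType) (n k : nat) :
  p \in [pchar R] -> (n < p)%N -> ('C(n, k)%:R == 0 :> R) = (n < k)%N.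
Proof.
move=> pcharR lt_np; have p_pr := pcharf_prime pcharR.
rewrite -(dvdn_pcharf pcharR); case: (ltnP n k) => [lt_nk|le_kn].
  by rewrite bin_small // dvdn0.
apply/negP=> /(dvdn_mulr (k`! * (n - k)`!)); rewrite bin_fact //.
by rewrite prime_dvd_fact // leqNgt lt_np.
Qed.

(** The indices are lowered by one. If [p] divides [j+1], then [j mod p = p-1] and the inequality
    fails; if [p] divides [i+1], its right side is 0; otherwise both sides say the same. *)
Lemma herm_vanishing (p i j : nat) : (0 < p)%N ->
  [/\ (i.+1%:Z <> 0 %[mod p%:Z])%Z, (j.+1%:Z <> 0 %[mod p%:Z])%Z
    & (i.+1%:Z %% p%:Z)%Z + (j.+1%:Z %% p%:Z)%Z <= p%:Z] <->
  (j %% p < (p - i.+1 %% p) %% p)%N.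
Proof.
move=> p_gt0; rewrite mod0z !modz_nat.
have := ltn_pmod i.+1 p_gt0; have := ltn_pmod j p_gt0.
have -> : (j.+1 %% p = if j %% p == p.-1 then 0 else (j %% p).+1)%N.
  rewrite -addn1 -modnDml; case: eqP => [->|neq].
    by rewrite addn1 prednK // modnn.
  by rewrite addn1 modn_small //; have := ltn_pmod j p_gt0; lia.
move: (i.+1 %% p)%N (j %% p)%N => a b lt_b lt_a.
have -> : ((p - a) %% p = if a == 0 then 0 else p - a)%N.
  by case: eqP => [->|neq]; [rewrite subn0 modnn | rewrite modn_small //; lia].
by case: ifP; case: ifP => Hb Ha; (split; [case; lia | move=> lt_ba; split; lia]).
Qed.

(** The difference form of the second index gives natural exponents without a proof that the index
    is positive. *)
Lemma herm_omega_sub (q : nat) (F : fieldType) (Omega : lmodType F)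
    (d : F -> Omega) (X Y : F) (a m n : nat) :
    X != 0 -> Y != 0 -> q.+1%:R = 1 :> F ->
  herm_omega q d X Y a.+1 (m.+1%:Z - n%:Z) =
    (X ^+ a * (Y ^+ m / Y ^+ n) / Y ^+ q) *: d X.
Proof.
move=> nzX nzY q1; rewrite /herm_omega q1 mulr1 expfzDr // -exprnN -!exprnP.
rewrite !exprS invfM; congr (_ *: _).
move: (X ^+ a) (Y ^+ m) (Y ^- n) (Y ^- q) => u v w t.
by field; rewrite nzX nzY.
Qed.

(** * The Cartier operator on the forms [herm_omega] *)

Theorem theorem3p2 (p e q : nat) (p_prime : prime p) (e_ge1 : (1 <= e)%N)
    (q_eq : q = (p ^ e)%N)
    (K : finFieldType) (card_K : #|K| = (q ^ 2)%N)
    (F : fieldType) (iota : {rmorphism K -> F}) (X Y : F)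
    (herm_F : hermitian_function_field q iota X Y)
    (Omega : lmodType F) (d : F -> Omega)
    (diff_Omega : differential_module iota d)
    (i j : int) (i_gt0 : 0 < i) (j_gt0 : 0 < j) (ij_lt : i + j < q.+1%:Z) :
  let C := cartier p iota d in
  let omega := herm_omega q d X Y in
  let vanishing :=
    [/\ (i <> 0 %[mod p%:Z])%Z, (j <> 0 %[mod p%:Z])%Z
      & (i %% p%:Z)%Z + (j %% p%:Z)%Z <= p%:Z] in
  (C (omega i j) = 0 <-> vanishing) /\
  (~ vanishing ->
   C (omega i j) =
     ((-1) ^ (herm_ceil p e j + j)
        * 'C(`|((j - 1) %% p%:Z)%Z|, `|((p%:Z - i) %% p%:Z)%Z|)%:R)
     *: omega (herm_tilde p e i) (herm_tilde p e j)).
Proof.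
move=> C omega vanishing; rewrite {}q_eq in card_K herm_F ij_lt omega *.
have q_eq : (p ^ e = p ^ e.-1 * p)%N by rewrite -expnSr prednK.
have cardK : #|K| = (p ^ (e * 2))%N by rewrite card_K expnM.
have pcharF : p \in [pchar F].
  by rewrite (fmorph_pchar iota); apply: card_finPcharP cardK p_prime.
have p_gt0 := prime_gt0 p_prime.
pose frob : {rmorphism F -> F} := pFrobenius_aut pcharF.
have frobE x : frob x = x ^+ p by [].
have iota_frob c : exists a, frob a = iota c.
  (* In the finite field, [c^(p^(2e)) = c] provides the p-th root. *)
  exists (iota (c ^+ (p ^ (e * 2).-1))); rewrite frobE -rmorphXn -exprM -expnSr.
  by rewrite prednK ?muln_gt0 ?e_ge1 // -cardK expf_card.
have [nzX nzY] := herm_XYneq0 herm_F.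
have q1 : (p ^ e).+1%:R = 1 :> F.
  by rewrite q_eq mulrSr natrM (pcharf0 pcharF) mulr0 add0r.
have X_npower := herm_npower pcharF e_ge1 herm_F frobE.
pose X_span := herm_span pcharF e_ge1 herm_F frobE iota_frob.
have sepX := herm_separating pcharF e_ge1 herm_F.
have dX0 := dX_neq0 pcharF frobE X_npower X_span iota_frob diff_Omega.
have CdX f := cartier_dX pcharF frobE X_npower X_span iota_frob diff_Omega f sepX.
(* From here [i] and [j] are naturals, one less than the original indices. *)
case: i i_gt0 ij_lt @vanishing => [[|i]|i] // _; case: j j_gt0 => [[|j]|j] // _ ij_lt.
set k := ((p - i.+1 %% p) %% p)%N; set j0 := (j %% p)%N; set j1 := (j %/ p)%N.
have lt_kp : (k < p)%N by rewrite ltn_mod.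
have lt_jp : (j0 < p)%N by rewrite ltn_mod.
have ej : j = (j1 * p + j0)%N by rewrite -divn_eq.
have [c ec] : exists c, (i.+1 + k = c.+1 * p)%N.
  have /dvdnP[[|c] ec] : (p %| i.+1 + k)%N; last by exists c.
    rewrite /dvdn modnDmr -modnDml subnKC ?modnn // ltnW // ltn_mod //.
  by move: ec; rewrite mul0n.
have ceil_i : herm_ceil p e i.+1 = c.+1.
  by apply: herm_ceil_nat => //; lia.
have ceil_j : herm_ceil p e j.+1 = j1.+1.
  by apply: herm_ceil_nat => //; lia.
have tilde_i : herm_tilde p e i.+1 = (p ^ e.-1 * k + c).+1.
  by rewrite /herm_tilde ceil_i q_eq; nia.
have tilde_j : herm_tilde p e j.+1 = (p ^ e + j1).+1%:Z - (p ^ e.-1 * j0.+1)%N%:Z.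
  by rewrite /herm_tilde ceil_j q_eq; nia.
have -> : `|((j.+1%:Z - 1) %% p%:Z)%Z|%N = j0.
  by rewrite (_ : j.+1%:Z - 1 = j%:Z) ?modz_nat //; lia.
have -> : `|((p%:Z - i.+1%:Z) %% p%:Z)%Z|%N = k.
  have -> : p%:Z - i.+1%:Z = - (i.+1 %/ p)%N%:Z * p%:Z + (p - i.+1 %% p)%N%:Z.
    have := divn_eq i.+1 p; have := ltn_pmod i.+1 p_gt0.
    by move: (_ %/ _)%N (_ %% _)%N => a b; lia.
  by rewrite modzMDl modz_nat.
(* The exponent is [j1 + j1 p + j0 + 2], and [(-1)^p = -1] in characteristic [p], including [p = 2],
   so the [j1] parts cancel. *)
have sign_j : (-1) ^ (herm_ceil p e j.+1 + j.+1%:Z) = (-1) ^+ j0 :> F.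
  rewrite ceil_j -[_ + _]/(j1.+1 + j.+1)%N%:Z -exprnP ej addSn addnS !exprS.
  rewrite mulrA mulrNN mulr1 mul1r addnA exprD exprD mulnC exprM -frobE.
  by rewrite rmorphN1 -exprMn mulrNN mulr1 expr1n mul1r.
(* The formula holds in all cases; since the form on the right is nonzero, [C] vanishes exactly when
   the binomial does. *)
have Comega : C (omega i.+1 j.+1) =
    ((-1) ^ (herm_ceil p e j.+1 + j.+1%:Z) * 'C(j0, k)%:R)
      *: omega (herm_tilde p e i.+1) (herm_tilde p e j.+1).
  have -> : omega i.+1 j.+1 = (X ^+ i * Y ^+ (j1 * p + j0) / Y ^+ (p ^ e)) *: d X.
    by rewrite -ej /omega -[j.+1%:Z]subr0 herm_omega_sub // divr1.
  rewrite /C CdX (herm_pcoef _ _ _ _ _ j1 lt_kp lt_jp ec) sign_j.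
  rewrite /omega tilde_i tilde_j herm_omega_sub // scalerA !exprD.
  congr (_ * _ *: _).
  have := expf_neq0 (p ^ e)%N nzY.
  move: (Y ^+ (p ^ e)) (Y ^+ j1) (Y ^- _) (X ^+ c) (X ^+ _) => y u v w x nzy.
  by field.
move=> vanishing; have vanE : vanishing <-> (j0 < k)%N by apply: herm_vanishing.
have tilde0 : omega (herm_tilde p e i.+1) (herm_tilde p e j.+1) != 0.
  rewrite /omega tilde_i tilde_j herm_omega_sub // scaler_eq0 (negPf dX0) orbF.
  by rewrite !(mulf_eq0, invr_eq0, expf_eq0) (negPf nzX) (negPf nzY) !andbF.
split=> [|_]; last exact: Comega.
rewrite vanE -(bin_pchar_eq0 k pcharF lt_jp) Comega; split=> [/eqP|/eqP ->].
  by rewrite scaler_eq0 mulf_eq0 sign_j signr_eq0 (negPf tilde0) orbF.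
by rewrite mulr0 scale0r.
Qed.
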